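(* Let $G$ be an abelian group and $S$ a finite subset of $\mathcal P_G$. Let $\mathbb F$ be an algebraically closed field and consider the action of $\mathrm{Fun}(G,\mathbb F^\times)$ on the affine space $\mathbb A_S$ given by $$\alpha\cdot(x_{\{g,h\}})_{\{g,h\}\in S}=\big(d\alpha(g,h)\,x_{\{g,h\}}\big)_{\{g,h\}\in S},\qquad d\alpha(g,h)=\alpha(g)\alpha(h)\alpha(gh)^{-1}.$$ Then the vanishing ideal in $\mathbb F[\mathbb A_S]$ of the Zariski closure of the orbit of $\bar 1_S$ in $\mathbb A_S$ is spanned over $\mathbb F$ by the binomials $r_1-r_2$, where $r_1,r_2$ are monomials in the variables indexed by $S$ such that $r_1r_2^{-1}\in\langle\mathcal R_G\rangle\cap\mathcal F_S$. More generally, for any $\varepsilon\in\mathrm T_S=\mathrm{Fun}(S,\mathbb F^\times)$, the vanishing ideal of the closure of the orbit of $\varepsilon$ is spanned over $\mathbb F$ by the binomials $\varepsilon(r_2)r_1-\varepsilon(r_1)r_2$ for such $r_1,r_2$, where $\varepsilon$ is identified with an element of $\mathrm{Hom}(\mathcal F_S,\mathbb F^\times)$ via $\mathrm{Fun}(S,\mathbb F^\times)=\mathrm{Hom}(\mathcal F_S,\mathbb F^\times)$.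
   Context: $G$ is written multiplicatively. $\mathcal P_G$ is the set of unordered pairs $\{g,h\}$ of elements of $G$ (with $g=h$ allowed). $\mathcal F_G$ is the free abelian group (written multiplicatively) on $\mathcal P_G$, $\mathcal R_G\subset\mathcal F_G$ is the set of all elements $\{g,h\}\{gh,k\}\{h,k\}^{-1}\{g,hk\}^{-1}$ with $g,h,k\in G$, and $\mathcal F_S\subset\mathcal F_G$ is the free abelian group on $S$. $\mathrm{Fun}(X,Y)$ is the set of all functions $X\to Y$ (a group under pointwise operation if $Y$ is a group). $\mathbb A_S=\mathbb F^S$ is the affine space with coordinates indexed by $S$ and coordinate algebra $\mathbb F[\mathbb A_S]=\mathbb F[x_i\mid i\in S]$; a monomial in the variables $x_i$ ($i\in S$) is identified with the corresponding element of $\mathcal F_S$ (with nonnegative exponents). $\mathrm T_S\subset\mathbb A_S$ is the torus of points with all coordinates nonzero, and $\bar1_S\in\mathbb A_S$ is the point with all coordinates equal to $1$. *)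

(* Defs.v *)
From HB Require Import structures.
From mathcomp Require Import all_boot all_order all_algebra.
From mathcomp Require Import finmap.
From mathcomp.multinomials Require Import monalg.

Set Implicit Arguments.
Unset Strict Implicit.
Unset Printing Implicit Defensive.

Import GRing.Theory.
Local Open Scope fset_scope.
Local Open Scope ring_scope.

(* Abelian groups are zmodTypes, hence in additive notation: the multiplicative
   g h, g h^-1 and 1 read g + h, g - h and 0, both in G and in the free abelian
   group on pairs.  The multiplicative group F^x of the field stays
   multiplicative. *)

(* Unordered pairs {g, h}, with g = h allowed: the subsets of G with one or two
   elements. *)
Section UnorderedPairs.
Variable G : choiceType.

Definition is_upair (A : {fset G}) : bool := (0 < #|` A| <= 2)%N.

Definition upairs := {A : {fset G} | is_upair A}.
HB.instance Definition _ := Choice.on upairs.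

Lemma upair_subproof (g h : G) : is_upair [fset g; h].
Proof. by rewrite /is_upair cardfs2; case: eqP. Qed.

Definition upair (g h : G) : upairs := exist _ [fset g; h] (upair_subproof g h).

Lemma upairC g h : upair g h = upair h g.
Proof. by apply: val_inj; rewrite /= fsetUC. Qed.

Lemma upair_surj (p : upairs) : exists gh : G * G, p == upair gh.1 gh.2.
Proof.
suff [g [h AE]] : exists g h, val p = [fset g; h].
  by exists (g, h); rewrite -val_eqE /= AE.
have /andP[] := valP p; rewrite cardfs_gt0 => /fset0Pn[g gp].
rewrite (cardfsD1 g) gp ltnS leq_eqVlt ltnS leqn0 => /orP[/cardfs1P[h hE]|].
  by exists g, h; rewrite -hE fsetD1K.
by rewrite cardfs_eq0 => /eqP E0; exists g, g; rewrite -(fsetD1K gp) E0 fsetU0 fsetUid.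
Qed.

Lemma upair_inj g h g' h' :
  upair g h = upair g' h' -> (g = g' /\ h = h') \/ (g = h' /\ h = g').
Proof.
move=> /(congr1 val) /= /fsetP E.
have := E g; have := E h; have := E g'; have := E h'.
rewrite !inE !eqxx ?orbT /= => /orP Eh' /orP Eg' /esym/orP Eh /esym/orP Eg.
case: Eg => /eqP gE; case: Eh => /eqP hE; [|by left|by right|].
- by left; split=> //; case: Eh' => /eqP ->; rewrite ?gE ?hE.
- by right; split=> //; case: Eg' => /eqP ->; rewrite ?gE ?hE.
Qed.

Definition upair_rep (p : upairs) : G * G := xchoose (upair_surj p).

Lemma upair_repK p : upair (upair_rep p).1 (upair_rep p).2 = p.
Proof. by apply/esym/eqP/(xchooseP (upair_surj p)). Qed.

End UnorderedPairs.

(* {malg K} = {malg int[K]} is the group of finitely supported functions K -> int,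
   i.e. the free abelian group on K, with basis << k >>, k : K. *)
Section Relations.
Variable G : zmodType.

Definition relator (r : {malg (upairs G)}) : Prop :=
  exists g h k : G,
    r = << upair g h >> + << upair (g + h) k >>
        - << upair h k >> - << upair g (h + k) >>.

Inductive gen_subgroup (V : zmodType) (B : V -> Prop) : V -> Prop :=
| gen_subgroup_mem v : B v -> gen_subgroup B v
| gen_subgroup0 : gen_subgroup B 0
| gen_subgroupB u v :
    gen_subgroup B u -> gen_subgroup B v -> gen_subgroup B (u - v).

Definition in_FS (S : {fset upairs G}) (r : {malg (upairs G)}) : Prop :=
  msupp r `<=` S.

End Relations.

Section AffineSpace.
Variables (G : zmodType) (S : {fset upairs G}) (F : fieldType).

Definition affS := {ffun S -> F}.

Definition torusS (x : affS) : Prop := forall i : S, x i != 0.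

Definition oneS : affS := [ffun=> 1].

(* The polynomial ring F[x_i | i in S]: {cmonom S} is the free commutative
   monoid on S. *)
Definition polyS := {malg F[{cmonom S}]}.

Definition evalS (x : affS) (p : polyS) : F :=
  mmap idfun (fun m : {cmonom S} => \prod_(i : S) x i ^+ m i) p.

Definition monS (m : {cmonom S}) : polyS := << m >>.

Definition mon_FS (m : {cmonom S}) : {malg (upairs G)} :=
  \sum_(i : S) << val i >> *+ m i.

(* The element of Hom(F_S, F^x) attached to a point of the torus; only its
   values on in_FS S are meaningful. *)
Definition homS (e : affS) (r : {malg (upairs G)}) : F :=
  \prod_(i : S) e i ^ r@_(val i).

(* Functions into F^x are nowhere vanishing functions into F. *)
Definition unit_fun (alpha : G -> F) : Prop := forall g, alpha g != 0.

Definition dfun (alpha : G -> F) (g h : G) : F :=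
  alpha g * alpha h * (alpha (g + h))^-1.

Lemma dfunC alpha g h : dfun alpha g h = dfun alpha h g.
Proof. by rewrite /dfun addrC [alpha g * _]mulrC. Qed.

(* The choice of representative is immaterial: see dpairE. *)
Definition dpair (alpha : G -> F) (p : upairs G) : F :=
  dfun alpha (upair_rep p).1 (upair_rep p).2.

Lemma dpairE alpha g h : dpair alpha (upair g h) = dfun alpha g h.
Proof.
rewrite /dpair; case: (upair_inj (upair_repK (upair g h))) => [] [-> ->] //.
exact: dfunC.
Qed.

Definition actS (alpha : G -> F) (x : affS) : affS :=
  [ffun i => dpair alpha (val i) * x i].

Lemma actS1 x : actS (fun=> 1) x = x.
Proof. by apply/ffunP=> i; rewrite ffunE /dpair /dfun invr1 !mul1r. Qed.

Lemma actSM alpha beta x :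
  actS (fun g => alpha g * beta g) x = actS alpha (actS beta x).
Proof.
apply/ffunP=> i; rewrite !ffunE /dpair /dfun /= [RHS]mulrA; congr (_ * _).
by rewrite invfM [X in X * _]mulrACA [LHS]mulrACA.
Qed.

Definition orbitS (x : affS) (y : affS) : Prop :=
  exists2 alpha : G -> F, unit_fun alpha & y = actS alpha x.

Definition zero_locus (I : polyS -> Prop) (x : affS) : Prop :=
  forall p, I p -> evalS x p = 0.

(* Intersection of all the Zariski closed sets containing X. *)
Definition zariski_closure (X : affS -> Prop) (x : affS) : Prop :=
  forall I : polyS -> Prop,
    (forall y, X y -> zero_locus I y) -> zero_locus I x.

Definition vanishing_ideal (X : affS -> Prop) (p : polyS) : Prop :=
  forall x, X x -> evalS x p = 0.

Definition lin_span (B : polyS -> Prop) (p : polyS) : Prop :=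
  exists (n : nat) (c : 'I_n -> F) (b : 'I_n -> polyS),
    (forall i, B (b i)) /\ p = \sum_(i < n) c i *: b i.

Definition rel_monS (r1 r2 : {cmonom S}) : Prop :=
  gen_subgroup (@relator G) (mon_FS r1 - mon_FS r2)
  /\ in_FS S (mon_FS r1 - mon_FS r2).

Definition binomial1 (q : polyS) : Prop :=
  exists r1 r2 : {cmonom S}, rel_monS r1 r2 /\ q = monS r1 - monS r2.

Definition binomial_tw (e : affS) (q : polyS) : Prop :=
  exists r1 r2 : {cmonom S}, rel_monS r1 r2 /\
    q = homS e (mon_FS r2) *: monS r1 - homS e (mon_FS r1) *: monS r2.

End AffineSpace.

(* Main.v *)
(* The monomial m takes on the point alpha . eps the value eps(m) times
   prod_g alpha(g)^(d m)(g), where d : F_S -> Z[G] sends {g, h} to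
   g + h - gh.  These are characters of Fun(G, F^x); since F is algebraically
   closed, they are equal exactly when the d m are, so Dedekind's independence
   of characters splits a polynomial vanishing on the orbit into pieces with
   constant d m, each of which is a combination of the twisted binomials.

   It remains to identify ker d with <R_G>.  The pairing (g, h) |-> {g, h} is a
   symmetric 2-cocycle with values in A = F_G / <R_G>, hence gives an abelian
   extension E of G by A.  If Z[G] -> E is the map lifting the set-theoretic
   section, then F_G -> Z[G] -> E is the projection onto A followed by the
   inclusion, so ker d is contained in <R_G>. *)
Require Import Defs.
From HB Require Import structures.
From mathcomp Require Import all_boot all_order all_algebra.
From mathcomp Require Import ring finmap boolp.
From mathcomp.multinomials Require Import monalg.

Set Implicit Arguments.
Unset Strict Implicit.
Unset Printing Implicit Defensive.

Import GRing.Theory.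
Local Open Scope fset_scope.
Local Open Scope quotient_scope.
Local Open Scope ring_scope.

(** * Homomorphisms out of a free abelian group *)

Section MalgLift.
Variables (K : choiceType) (V : zmodType) (h : K -> V).

Definition malg_lift (u : {malg K}) : V := \sum_(k <- msupp u) h k *~ u@_k.

Lemma malg_liftEw (d : {fset K}) (u : {malg K}) :
  msupp u `<=` d -> malg_lift u = \sum_(k <- d) h k *~ u@_k.
Proof.
move=> le_ud; apply: big_fset_incl => // k _ /mcoeff_outdom ->.
by rewrite mulr0z.
Qed.

Lemma malg_lift_is_zmod_morphism : zmod_morphism malg_lift.
Proof.
move=> u v; pose d := msupp u `|` msupp v.
rewrite !(@malg_liftEw d) ?fsubsetUl ?fsubsetUr ?msuppB_le // -sumrB.
by apply: eq_bigr => k _; rewrite mcoeffB mulrzBr.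
Qed.

HB.instance Definition _ :=
  GRing.isZmodMorphism.Build {malg K} V malg_lift malg_lift_is_zmod_morphism.

Lemma malg_liftU (k : K) : malg_lift << k >> = h k.
Proof. by rewrite /malg_lift msuppU big_seq_fset1 mcoeffUU. Qed.

End MalgLift.

Lemma malg_additive_ext (K : choiceType) (V : zmodType)
    (f g : {additive {malg K} -> V}) :
  (forall k, f << k >> = g << k >>) -> f =1 g.
Proof.
move=> fg u; rewrite (monalgE u) !raddf_sum; apply: eq_bigr => k _.
suff -> : << u@_k *g k >> = (<< k >> : {malg K}) *~ u@_k by rewrite !raddfMz fg.
by rewrite -raddfMz /= intz.
Qed.

(** * Characters of a free abelian group *)

Section MultiplicativeLift.
Variables (K : choiceType) (F : fieldType).
Implicit Types (a b : K -> F) (u v : {malg K}).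

(** The multiplicative counterpart of [malg_lift], kept separate because F^x appears here only as
    the nonzero elements of [F]. *)
Definition malg_prod a u : F := \prod_(k <- msupp u) a k ^ u@_k.

Lemma malg_prodEw a (d : {fset K}) u :
  msupp u `<=` d -> malg_prod a u = \prod_(k <- d) a k ^ u@_k.
Proof.
move=> le_ud; apply: big_fset_incl => // k _ /mcoeff_outdom ->.
by rewrite expr0z.
Qed.

Lemma malg_prodD a u v : (forall k, a k != 0) ->
  malg_prod a (u + v) = malg_prod a u * malg_prod a v.
Proof.
move=> a0; pose d := msupp u `|` msupp v.
rewrite !(@malg_prodEw _ d) ?fsubsetUl ?fsubsetUr ?msuppD_le // -big_split.
by apply: eq_bigr => k _; rewrite mcoeffD expfzDr.
Qed.

Lemma malg_prod0 a : malg_prod a 0 = 1.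
Proof. by rewrite /malg_prod msupp0 big_seq_fset0. Qed.

Lemma malg_prodU a (k : K) : malg_prod a << k >> = a k.
Proof. by rewrite /malg_prod msuppU big_seq_fset1 mcoeffUU expr1z. Qed.

Lemma malg_prodN a u : (forall k, a k != 0) ->
  malg_prod a (- u) = (malg_prod a u)^-1.
Proof.
move=> a0; rewrite /malg_prod msuppN -prodfV; apply: eq_bigr => k _.
by rewrite mcoeffN invr_expz.
Qed.

Lemma malg_prodMn a u n : (forall k, a k != 0) ->
  malg_prod a (u *+ n) = malg_prod a u ^+ n.
Proof.
move=> a0; elim: n => [|n IHn]; first by rewrite mulr0n malg_prod0.
by rewrite mulrS malg_prodD // IHn exprS.
Qed.

Lemma malg_prod_sum (I : Type) (r : seq I) a (u : I -> {malg K}) :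
  (forall k, a k != 0) ->
  malg_prod a (\sum_(i <- r) u i) = \prod_(i <- r) malg_prod a (u i).
Proof.
move=> a0; elim: r => [|i r IHr]; first by rewrite !big_nil malg_prod0.
by rewrite !big_cons malg_prodD // IHr.
Qed.

Lemma malg_prodM a b u :
  malg_prod (fun k => a k * b k) u = malg_prod a u * malg_prod b u.
Proof. by rewrite -big_split; apply: eq_bigr => k _; rewrite expfzMl. Qed.

Lemma malg_prod_neq0 a u : (forall k, a k != 0) -> malg_prod a u != 0.
Proof.
move=> a0; apply: (big_ind (fun x => x != 0)); first exact: oner_neq0.
  by move=> x y x0 y0; rewrite mulf_neq0.
by move=> k _; apply: expfz_neq0. Qed.

(** Functions of this kind read off single coefficients, which will separate characters. *)
Lemma malg_prod_single (t : F) (k : K) u :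
  malg_prod (fun j => if j == k then t else 1) u = t ^ u@_k.
Proof.
(* Adding [k] to the range covers the case where [k] is outside the support and the exponent is
   0. *)
rewrite (@malg_prodEw _ (k |` msupp u)) ?fsubsetU1 //.
rewrite (big_fsetD1 k) ?fset1U1 //= eqxx big1_fset ?mulr1 // => j.
by rewrite !inE => /andP[/negPf -> _] _; rewrite exp1rz.
Qed.
End MultiplicativeLift.

(** * Abelian extensions from symmetric 2-cocycles *)

(* The abelian extension of G by A with symmetric 2-cocycle c; its zero is
   (- c 0 0, 0) because c is not assumed to be normalized. *)
Definition twisted_sum (A G : zmodType) (c : G -> G -> A)
  (cC : forall g h, c g h = c h g)
  (cA : forall g h k, c g h + c (g + h) k = c h k + c g (h + k)) : Type :=
  (A * G)%type.

Section TwistedSum.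
Variables (A G : zmodType) (c : G -> G -> A).
Hypothesis cC : forall g h, c g h = c h g.
Hypothesis cA : forall g h k, c g h + c (g + h) k = c h k + c g (h + k).

Local Notation E := (twisted_sum cC cA).

HB.instance Definition _ := Choice.on E.

Definition twisted_zero : E := (- c 0 0, 0).
(** One correction cancels the cocycle value on [x.2] and [- x.2]; the other accounts for the
    shifted zero. *)
Definition twisted_opp (x : E) : E := (- x.1 - c x.2 (- x.2) - c 0 0, - x.2).
Definition twisted_add (x y : E) : E := (x.1 + y.1 + c x.2 y.2, x.2 + y.2).

Lemma cocycle0 (g : G) : c 0 g = c 0 0.
Proof. by have := cA 0 0 g; rewrite !add0r => /addIr. Qed.

Lemma twisted_addA : associative twisted_add.
Proof.
move=> [a g] [b h] [d k]; congr (_, _); rewrite /= -!addrA //.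
by congr (a + (b + _)); rewrite -cA addrCA.
Qed.

Lemma twisted_addC : commutative twisted_add.
Proof.
by move=> [a g] [b h]; rewrite /twisted_add /= cC (addrC a) (addrC g).
Qed.

Lemma twisted_add0 : left_id twisted_zero twisted_add.
Proof.
by move=> [a g]; rewrite /twisted_add /= cocycle0 add0r addrAC addNr add0r.
Qed.

Lemma twisted_addN : left_inverse twisted_zero twisted_opp twisted_add.
Proof.
move=> [a g]; rewrite /twisted_add /= addNr; congr (_, _).
by rewrite (cC (- g)) -(addrA _ a) -opprD addrAC addNr add0r.
Qed.

HB.instance Definition _ :=
  GRing.isZmodule.Build E twisted_addA twisted_addC twisted_add0 twisted_addN.

(** The shift by [c 0 0] sends 0 to [twisted_zero] and makes the inclusion additive. *)
Definition twisted_in (a : A) : E := (a - c 0 0, 0).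

Lemma twisted_in_is_nmod_morphism : nmod_morphism twisted_in.
Proof.
split=> [|a b]; first by rewrite /twisted_in sub0r.
congr (_, _); last by rewrite /= addr0.
by rewrite /= -!addrA addNr addr0 [in RHS](addrC _ b) addrA.
Qed.

HB.instance Definition _ :=
  GRing.isNmodMorphism.Build A E twisted_in twisted_in_is_nmod_morphism.

Lemma twisted_in_inj : injective twisted_in.
Proof. by move=> a b [/addIr]. Qed.

(** The section g |-> (0, g) has [c] as its defect of additivity. *)
Lemma twisted_cocycle (g h : G) :
  ((0, g) : E) + (0, h) = (twisted_in (c g h)) + (0, g + h).
Proof.
congr (_, _); last by rewrite /= add0r.
by rewrite /= cocycle0 !addr0 add0r subrK.
Qed.

End TwistedSum.

(** * Quotient by a generated subgroup *)

Section QuotientByGenerators.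
Variables (V : zmodType) (B : V -> Prop).

Definition gen_pred : pred V := fun u => `[< gen_subgroup B u >].

Lemma gen_pred_zmod_closed : zmod_closed gen_pred.
Proof.
split=> [|u v /asboolP u_in /asboolP v_in]; apply/asboolP.
  exact: gen_subgroup0.
exact: gen_subgroupB.
Qed.

HB.instance Definition _ :=
  GRing.isZmodClosed.Build V gen_pred gen_pred_zmod_closed.

Lemma gen_subgroup_quotient :
  exists (A : zmodType) (f : {additive V -> A}),
    forall u, f u = 0 <-> gen_subgroup B u.
Proof.
pose Q := Quotient.quot (GRing.ZmodClosed.clone _ gen_pred _).
exists Q, (\pi_Q : {additive V -> Q}) => u.
have piE : (u - 0 \in gen_pred) = (u == 0 %[mod Q]) := Quotient.idealrBE _ _ _.
have -> : (0 : Q) = \pi_Q 0 by rewrite raddf0.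
split=> [/eqP|u_in]; first by rewrite -piE subr0 => /asboolP.
by apply/eqP; rewrite -piE subr0; apply/asboolP.
Qed.

End QuotientByGenerators.

(** * The boundary map and its kernel *)

Section Boundary.
Variable G : zmodType.

Definition boundary_gen (p : upairs G) : {malg G} :=
  << (upair_rep p).1 >> + << (upair_rep p).2 >>
    - << (upair_rep p).1 + (upair_rep p).2 >>.

Definition boundary (u : {malg (upairs G)}) : {malg G} :=
  malg_lift boundary_gen u.

Lemma boundary0 : boundary 0 = 0. Proof. exact: raddf0. Qed.

Lemma boundaryD u v : boundary (u + v) = boundary u + boundary v.
Proof. exact: raddfD. Qed.

Lemma boundaryB u v : boundary (u - v) = boundary u - boundary v.
Proof. exact: raddfB. Qed.

Lemma boundaryU (g h : G) :
  boundary << upair g h >> = << g >> + << h >> - << g + h >>.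
Proof.
rewrite /boundary /= malg_liftU /boundary_gen.
have [[-> ->] //|[-> ->]] := upair_inj (upair_repK (upair g h)).
by rewrite (addrC h) (addrC << h >>).
Qed.

(** Both halves of a relator have boundary [g] + [h] + [k] - [g + h + k]. *)
Lemma boundary_relator u : gen_subgroup (@relator G) u -> boundary u = 0.
Proof.
elim=> [_ [g [h [k ->]]]||v w _ v0 _ w0]; last 2 first.
- exact: boundary0.
- by rewrite boundaryB v0 w0 subr0.
rewrite !boundaryB boundaryD.
(* Through variables, because rewriting with boundaryU would unfold distinct
   basis elements to compare them. *)
suff H (V : zmodType) (x y z w s t b1 b2 b3 b4 : V) :
    b1 = x + y - z -> b2 = z + w - t -> b3 = y + w - s -> b4 = x + s - t ->
    b1 + b2 - b3 - b4 = 0.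
  apply: H (boundaryU g h) (boundaryU (g + h) k) (boundaryU h k) _.
  by rewrite -(addrA g h k); exact: (boundaryU g (h + k)).
move=> -> -> -> ->; apply/eqP; rewrite -addrA -opprD subr_eq0; apply/eqP.
by rewrite (addrC x s) !addrA !subrK -(addrA x) (addrC x).
Qed.

Lemma boundary_eq0 u : boundary u = 0 <-> gen_subgroup (@relator G) u.
Proof.
split=> [u0|]; last exact: boundary_relator.
have [A [f fP]] := gen_subgroup_quotient (@relator G).
pose c g h := f << upair g h >>.
have cC g h : c g h = c h g by rewrite /c upairC.
have cA g h k : c g h + c (g + h) k = c h k + c g (h + k).
  apply/subr0_eq; rewrite /c opprD addrA -raddfD -!raddfB; apply/fP.
  by apply: gen_subgroup_mem; exists g, h, k.
pose E := twisted_sum cC cA; pose s (g : G) : E := (0, g).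
apply/fP/(@twisted_in_inj _ _ _ cC cA).
(* Writing 0 as [malg_lift s (boundary u)] turns the goal into an equality of two homomorphisms,
   which can be checked on pairs. *)
rewrite raddf0 -(raddf0 (malg_lift s)) -u0; move: u {u0}.
apply: (@malg_additive_ext _ E (@twisted_in _ _ _ cC cA \o f)
                                (malg_lift s \o boundary)) => p /=.
have [g [h ->]] : exists g h, p = upair g h.
  by exists (upair_rep p).1, (upair_rep p).2; rewrite upair_repK.
rewrite -/(boundary _) boundaryU.
have -> : malg_lift s (<< g >> + << h >> - << g + h >>) = s g + s h - s (g + h).
  by rewrite raddfB raddfD -!(malg_liftU s).
by rewrite /s twisted_cocycle addrK.
Qed.

End Boundary.

(** * Independence and separation of characters *)

(* Artin's argument: multiplying the given relation by chi (kappa i) b - chi x b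
   for a suitable b kills the class of x and only rescales that of k. *)
Lemma dedekind_classes (K I : eqType) (F : fieldType) (M : Type) (P : M -> Prop)
    (op : M -> M -> M) (chi : K -> M -> F) (kappa : I -> K) (c : I -> F)
    (s : seq I) :
  (exists a, P a) -> (forall a b, P a -> P b -> P (op a b)) ->
  (forall k a b, P a -> P b -> chi k (op a b) = chi k a * chi k b) ->
  (forall k a, P a -> chi k a != 0) ->
  (forall k l, k != l -> exists2 a, P a & chi k a != chi l a) ->
  (forall a, P a -> \sum_(i <- s) c i * chi (kappa i) a = 0) ->
  forall k, \sum_(i <- s | kappa i == k) c i = 0.
Proof.
move=> [a0 Pa0] Pop chiM chi_neq0 chi_sep rel k.
(* The factor [lam] rescales whole classes and preserves the relation; it is built by killing the
   classes in [t] one at a time. *)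
have kill (t : seq K) : k \notin t ->
    exists lam : K -> F, [/\ {in t, forall x, lam x = 0}, lam k != 0 &
      forall a, P a -> \sum_(i <- s) lam (kappa i) * c i * chi (kappa i) a = 0].
  elim: t => [_|x t IHt].
    exists (fun=> 1); split=> // [|a Pa]; first exact: oner_neq0.
    by rewrite -[RHS](rel a Pa); apply: eq_bigr => i _; rewrite mul1r.
  rewrite inE negb_or => /andP[kx /IHt[lam [lam0 lamk lam_rel]]].
  have [b Pb chi_b] := chi_sep _ _ kx.
  exists (fun y => lam y * (chi y b - chi x b)); split=> [y||a Pa].
  - by rewrite inE => /predU1P[->|/lam0 ->]; rewrite ?subrr ?mulr0 ?mul0r.
  - by rewrite mulf_neq0 // subr_eq0.
  pose rel_at z := \sum_(i <- s) lam (kappa i) * c i * chi (kappa i) z.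
  transitivity (rel_at (op a b) - chi x b * rel_at a); last first.
    by rewrite /rel_at !lam_rel ?mulr0 ?subrr //; apply: Pop.
  rewrite mulr_sumr -sumrB.
  by apply: eq_bigr => i _; rewrite chiM //; ring.
(* With [t] the classes in [s] other than [k], only the total of class [k] survives evaluation at
   [a0]. *)
have [|lam [lam0 lamk lam_rel]] := kill [seq kappa i | i <- s & kappa i != k].
  by apply/mapP=> -[i]; rewrite mem_filter => /andP[/eqP ik _] /esym.
have : \sum_(i <- s) lam (kappa i) * c i * chi (kappa i) a0
    = lam k * chi k a0 * \sum_(i <- s | kappa i == k) c i.
  rewrite mulr_sumr [RHS]big_mkcond; apply: eq_big_seq => i si /=.
  case: eqP => [->|/eqP ik]; first by ring.
  by rewrite lam0 ?mul0r // map_f // mem_filter ik.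
rewrite lam_rel // => /esym/eqP; rewrite !mulf_eq0 (negPf lamk).
by rewrite (negPf (chi_neq0 _ _ Pa0)) => /eqP.
Qed.

(** Algebraic closedness enters here: the character t |-> t^z of F^x is nontrivial for each nonzero
    z. *)
Lemma expfz_eq1_closed (F : closedFieldType) (z : int) :
  z != 0 -> exists2 t : F, t != 0 & t ^ z != 1.
Proof.
move=> z0.
suff [t t0 tn] : exists2 t : F, t != 0 & t ^+ `|z|%N != 1.
  exists t => //; case: z z0 tn => [m|m] _ //.
  by rewrite NegzE -invr_expz invr_eq1.
have : (0 < `|z|)%N by rewrite absz_gt0.
move: `|z|%N => n n_gt0.
(* A root of X^(n+1) - X + 1: it is nonzero and not an n-th root of unity. *)
have [t tE] :=
  @solve_monicpoly F n.+1 (fun i => if i == 0 then -1 else (i == 1)%:R) isT.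
have {}tE : t ^+ n.+1 = t - 1.
  rewrite tE; case: n n_gt0 {tE} => // n _.
  rewrite !big_ord_recl big1 => [|i _]; last by rewrite mul0r.
  by rewrite /= expr0 expr1 mulr1 mul1r addr0 addrC.
exists t; apply/eqP => t1; move: tE.
  by rewrite t1 expr0n sub0r => /esym/eqP; rewrite oppr_eq0 oner_eq0.
rewrite exprS t1 mulr1 => /esym/eqP; rewrite -subr_eq0 addrAC subrr sub0r.
by rewrite oppr_eq0 oner_eq0.
Qed.

(** * Polynomials on an orbit *)

Section Orbits.
Variables (G : zmodType) (S : {fset upairs G}) (F : fieldType).
Implicit Types (alpha : G -> F) (e : affS S F) (m : {cmonom S}).
Implicit Types (p : polyS S F).

(** Adjointness of the two maps d, on functions and on pairs. *)
Lemma malg_prod_boundary alpha m : unit_fun alpha ->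
  malg_prod alpha (boundary (mon_FS m))
  = \prod_(i : S) dpair alpha (val i) ^+ m i.
Proof.
move=> a0; rewrite /boundary /mon_FS raddf_sum /= malg_prod_sum //.
apply: eq_bigr => i _; rewrite raddfMn malg_prodMn //=; congr (_ ^+ _).
rewrite malg_liftU /boundary_gen malg_prodD // malg_prodD //.
by rewrite malg_prodN // 3!malg_prodU.
Qed.

Lemma mcoeff_mon_FS m (i : S) : (mon_FS m)@_(val i) = m i.
Proof.
rewrite raddf_sum (bigD1 i) //= big1 => [|j ji]; rewrite raddfMn /= mcoeffU.
  by rewrite eqxx addr0 -mulrnA mul1n natz.
by rewrite (inj_eq val_inj) (negPf ji) mul0rn.
Qed.

Lemma homS_mon e m : homS e (mon_FS m) = \prod_(i : S) e i ^+ m i.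
Proof. by apply: eq_bigr => i _; rewrite mcoeff_mon_FS. Qed.

Lemma homS_mon_neq0 e m : torusS e -> homS e (mon_FS m) != 0.
Proof.
by move=> e0; rewrite homS_mon; apply/prodf_neq0 => i _; apply: expf_neq0.
Qed.

Lemma homS_one m : homS (oneS S F) (mon_FS m) = 1.
Proof. by rewrite homS_mon big1 // => i _; rewrite ffunE expr1n. Qed.

Lemma binomial_oneS (r1 r2 : {cmonom S}) :
  homS (oneS S F) (mon_FS r2) *: monS F r1
    - homS (oneS S F) (mon_FS r1) *: monS F r2
  = monS F r1 - monS F r2.
Proof.
have comb (V : lmodType F) (x y : V) (a b : F) :
    a = 1 -> b = 1 -> a *: x - b *: y = x - y.
  by move=> -> ->; rewrite !scale1r.
exact: comb (homS_one r2) (homS_one r1).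
Qed.

Lemma mon_FS_in_FS (r1 r2 : {cmonom S}) : in_FS S (mon_FS r1 - mon_FS r2).
Proof.
apply/fsubsetP => q; apply: contraLR => qS.
rewrite -mcoeff_neq0 negbK mcoeffB.
suff mon0 (m : {cmonom S}) : (mon_FS m)@_q = 0 by rewrite !mon0 subrr.
rewrite raddf_sum big1 // => i _; rewrite raddfMn /= mcoeffU.
by case: eqP qS => [<-|_ _]; [rewrite fsvalP|rewrite mul0rn].
Qed.

(** Related monomials are those giving the same character of Fun(G, F^x). *)
Lemma rel_monSE (r1 r2 : {cmonom S}) :
  rel_monS r1 r2 <-> boundary (mon_FS r1) = boundary (mon_FS r2).
Proof.
split=> [[/boundary_eq0 + _]|eqb]; first by rewrite boundaryB => /subr0_eq.
split; last exact: mon_FS_in_FS.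
by apply/boundary_eq0; rewrite boundaryB eqb subrr.
Qed.

Lemma prod_actS alpha e m : unit_fun alpha ->
  \prod_(i : S) actS alpha e i ^+ m i
  = homS e (mon_FS m) * malg_prod alpha (boundary (mon_FS m)).
Proof.
move=> a0; rewrite homS_mon malg_prod_boundary // -big_split.
by apply: eq_bigr => i _; rewrite ffunE exprMn mulrC.
Qed.

Lemma evalS_orbit alpha e p : unit_fun alpha ->
  evalS (actS alpha e) p = \sum_(m <- msupp p)
    p@_m * homS e (mon_FS m) * malg_prod alpha (boundary (mon_FS m)).
Proof.
by move=> a0; apply: eq_bigr => m _; rewrite /= -mulrA prod_actS.
Qed.

Lemma evalSB e p q : evalS e (p - q) = evalS e p - evalS e q.
Proof. exact: raddfB. Qed.

Lemma evalS_sum e (I : Type) (r : seq I) (q : I -> polyS S F) :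
  evalS e (\sum_(i <- r) q i) = \sum_(i <- r) evalS e (q i).
Proof. exact: raddf_sum. Qed.

Lemma evalSZ e c p : evalS e (c *: p) = c * evalS e p.
Proof.
rewrite /evalS (mmapEw (msuppZ_le _ _)) mmapE mulr_sumr.
by apply: eq_bigr => m _; rewrite mcoeffZ mulrA.
Qed.

Lemma evalS_mon e m : evalS e (monS F m) = \prod_(i : S) e i ^+ m i.
Proof. by rewrite /evalS mmapU mul1r. Qed.

Lemma evalS_binomial e a b m m' :
  evalS e (a *: monS F m - b *: monS F m')
  = a * \prod_(i : S) e i ^+ m i - b * \prod_(i : S) e i ^+ m' i.
Proof. by rewrite evalSB -!evalS_mon -!evalSZ. Qed.

(** The zero locus of [p] alone is one of the closed sets being intersected. *)
Lemma vanishing_ideal_closure (X : affS S F -> Prop) p :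
  vanishing_ideal (zariski_closure X) p <-> vanishing_ideal X p.
Proof.
split=> [van x Xx|van x]; first by apply: van => I; apply.
by move/(_ (eq p)); apply=> // y Xy _ <-; apply: van.
Qed.

(** The linear algebra behind the spanning claim: modulo the binomials of a class, a monomial is
    determined by its weight [w]. *)
Lemma binomial_span (K : eqType) (kappa : {cmonom S} -> K)
    (w : {cmonom S} -> F) p :
  (forall m, w m != 0) ->
  (forall k, \sum_(m <- msupp p | kappa m == k) p@_m * w m = 0) ->
  lin_span (fun q => exists r1 r2, kappa r1 = kappa r2 /\
                       q = w r2 *: monS F r1 - w r1 *: monS F r2) p.
Proof.
move=> w0 classes0.
(* [choose] returns the same element from any starting point in the class, so [rho] is constant on
   classes. *)
pose rho m := choose [pred m' | kappa m' == kappa m] m.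
have kappa_rho m : kappa (rho m) = kappa m.
  by apply/eqP; apply: (@chooseP _ [pred m' | kappa m' == kappa m]) => /=.
have rho_eq m m' : kappa m = kappa m' -> rho m = rho m'.
  move=> mm'; rewrite /rho mm'; apply: choose_id => /=; first by rewrite mm'.
  exact: eqxx.
(* Trading each monomial for its representative changes p by the sum of the
   class totals, which vanish. *)
pose s : seq {cmonom S} := msupp p.
pose b m := w (rho m) *: monS F m - w m *: monS F (rho m).
pose mon := tnth (in_tuple s).
exists (size s), (fun i => p@_(mon i) / w (rho (mon i))), (b \o mon).
split=> [i|]; first by exists (mon i), (rho (mon i)).
rewrite -(big_tnth _ _ s predT (fun m => (p@_m / w (rho m)) *: b m)).
have {1}-> : p = \sum_(m <- s) p@_m *: monS F m.
  rewrite {1}[p]monalgE; apply: eq_bigr => m _.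
  apply/malgP => k; transitivity (p@_m *+ (m == k)); first exact: mcoeffU.
  by rewrite mcoeffZ mcoeffU mulrnAr mulr1.
apply/eqP; rewrite -subr_eq0 -sumrB; apply/eqP.
transitivity (\sum_(m <- s) (p@_m * w m / w (rho m)) *: monS F (rho m)).
  apply: eq_bigr => m _.
  have comb (V : lmodType F) (x y : V) (d a c : F) : a != 0 ->
      d *: x - (d / a) *: (a *: x - c *: y) = (d * c / a) *: y.
    by move=> a0; rewrite scalerBr !scalerA divfK // opprB addrC subrK mulrAC.
  exact: comb.
apply/malgP => k; rewrite mcoeff0 raddf_sum /=.
under eq_bigr => m _ do rewrite mcoeffZ mcoeffU.
(* Only representatives occur in the sum, as [rho] is idempotent. *)
case: (eqVneq (rho k) k) => [rho_k|rho_k]; last first.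
  rewrite big1_seq // => m _; case: eqP => [mk|_]; last by rewrite mulr0.
  by case/eqP: rho_k; rewrite -mk; apply: rho_eq.
transitivity ((\sum_(m <- s | kappa m == kappa k) p@_m * w m) / w k); last first.
  by rewrite classes0 mul0r.
rewrite mulr_suml [RHS]big_mkcond; apply: eq_bigr => m _ /=.
have -> : (rho m == k) = (kappa m == kappa k).
  by apply/eqP/eqP => [<-|/rho_eq ->].
case: eqP => [/rho_eq ->|_]; last by rewrite mulr0.
by rewrite rho_k mulr1.
Qed.

End Orbits.

(** * Vanishing ideals of orbit closures *)

Lemma lin_span_sub (G : zmodType) (S : {fset upairs G}) (F : fieldType)
    (B B' : polyS S F -> Prop) :
  (forall q, B q -> B' q) -> forall p, lin_span B p -> lin_span B' p.
Proof.
by move=> BB' p [n [c [b [Bb ->]]]]; exists n, c, b; split=> // i; apply: BB'.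
Qed.

Lemma orbit_ideal (G : zmodType) (S : {fset upairs G}) (F : closedFieldType)
    (e : affS S F) (p : polyS S F) : torusS e ->
  vanishing_ideal (zariski_closure (orbitS e)) p <-> lin_span (binomial_tw e) p.
Proof.
move=> e0; rewrite vanishing_ideal_closure; split=> [van|[n [c [b [Bb ->]]]] x].
  apply: (lin_span_sub _ (@binomial_span _ _ _ _
            (fun m => boundary (mon_FS m)) (fun m => homS e (mon_FS m)) _ _ _)).
  - by move=> q [r1 [r2 [/rel_monSE r12 ->]]]; exists r1, r2.
  - by move=> m; apply: homS_mon_neq0.
  apply: (@dedekind_classes _ _ _ (G -> F) (@unit_fun G F)
            (fun alpha beta g => alpha g * beta g)
            (fun k alpha => malg_prod alpha k)).
  - by exists (fun=> 1) => g; apply: oner_neq0.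
  - by move=> alpha beta a0 b0 g; rewrite mulf_neq0.
  - by move=> k alpha beta _ _; rewrite malg_prodM.
  - by move=> k alpha a0; apply: malg_prod_neq0.
  - move=> k l kl; have [g klg] : exists g, k@_g != l@_g.
      apply: contrapT => eqkl; case/eqP: kl; apply/malgP => g.
      by apply: contrapT => /eqP klg; apply: eqkl; exists g.
    have [t t0 tkl] : exists2 t : F, t != 0 & t ^ (k@_g - l@_g) != 1.
      by apply: expfz_eq1_closed; rewrite subr_eq0.
    (* The two characters take the values t^(k_g) and t^(l_g) on this function. *)
    exists (fun j => if j == g then t else 1).
      by move=> j; case: ifP => _ //; apply: oner_neq0.
    rewrite !malg_prod_single; apply: contra_neq tkl => tkl.
    by rewrite expfzDr // tkl -expfzDr // subrr expr0z.
  - move=> alpha a0; rewrite -[RHS](van (actS alpha e)); last by exists alpha.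
    by rewrite evalS_orbit.
(* At alpha . e both terms of a binomial equal e(r1) e(r2) alpha(d r1). *)
move=> [alpha a0 ->]; rewrite evalS_sum big1 // => i _; rewrite evalSZ.
have [r1 [r2 [/rel_monSE r12 ->]]] := Bb i.
by rewrite evalS_binomial !prod_actS // r12 mulrCA subrr mulr0.
Qed.

Theorem theorem27 (G : zmodType) (S : {fset upairs G}) (F : closedFieldType) :
  (forall p : polyS S F,
     vanishing_ideal (zariski_closure (orbitS (oneS S F))) p
     <-> lin_span (@binomial1 G S F) p)
  /\
  (forall eps : affS S F, torusS eps ->
     forall p : polyS S F,
       vanishing_ideal (zariski_closure (orbitS eps)) p
       <-> lin_span (binomial_tw eps) p).
Proof.
split=> [p|eps]; last by move=> eps0 p; apply: orbit_ideal.
rewrite orbit_ideal; last by move=> i; rewrite ffunE oner_neq0.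
by split; apply: lin_span_sub => _ [r1 [r2 [r12 ->]]]; exists r1, r2;
  rewrite binomial_oneS.
Qed.
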